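(* Let $k$ be a field, let $1\le t<n<v$ be integers, let $(V,B)$ be a Steiner system of type $S(t,n,v)$ with $V=\{1,\dots,v\}$, and let $\mathcal H=\{H_1,\dots,H_v\}$ be a collection of $v$ distinct hyperplanes in $\mathbb P^n_k$ such that any $n$ of them meet in exactly one point and any $n+1$ of them have empty intersection. Let $I\subseteq k[x_0,\dots,x_n]$ be the ideal defining the Complement of the Steiner configuration of points associated to $(V,B)$ with respect to $\mathcal H$. Then the resurgence of $I$ satisfies $\rho(I)<n$.
   Context: A Steiner system $(V,B)$ of type $S(t,n,v)$ is a set $V$ with $|V|=v$ together with a collection $B$ of $n$-element subsets of $V$ (blocks) such that each $t$-element subset of $V$ is contained in a unique block. Let $\ell_j\in k[x_0,\dots,x_n]$ be a linear form defining $H_j$. For an $n$-element subset $\sigma=\{\sigma_1,\dots,\sigma_n\}\subseteq V$, let $P_{\mathcal H,\sigma}=H_{\sigma_1}\cap\dots\cap H_{\sigma_n}$, a point of $\mathbb P^n_k$ with vanishing ideal $I_{P_{\mathcal H,\sigma}}=(\ell_{\sigma_1},\dots,\ell_{\sigma_n})$. Let $C_{(n,v)}$ be the set of all $n$-element subsets of $V$. The Complement of the Steiner configuration of points is $X_C=\bigcup_{\sigma\in C_{(n,v)}\setminus B}P_{\mathcal H,\sigma}$, with defining ideal $I=\bigcap_{\sigma\in C_{(n,v)}\setminus B}I_{P_{\mathcal H,\sigma}}$. For a radical ideal $I$, the $m$-th symbolic power is $I^{(m)}=\bigcap_{\mathfrak p\in \mathrm{Ass}(I)}\mathfrak p^m$.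 The resurgence of a nonzero proper ideal $I$ is $\rho(I)=\sup\{m/r : m,r\ge 1 \text{ integers},\ I^{(m)}\nsubseteq I^r\}$. *)

(* Defs.v *)
From HB Require Import structures.
From mathcomp Require Import all_boot all_order all_algebra.
From mathcomp Require Import classical_sets reals ereal.
(* Some notations of mpoly have parsing levels incompatible with those of
   classical_sets, so {mpoly k[n]} and d.-homog are written [mpoly n k] and
   [ishomog1 d mdeg] below. *)
From mathcomp Require Import -(notations) mpoly.

Set Implicit Arguments.
Unset Strict Implicit.
Unset Printing Implicit Defensive.

Import Order.TTheory GRing.Theory Num.Theory.

Local Open Scope classical_set_scope.
Local Open Scope ring_scope.

Section Ideals.
Variable A : comNzRingType.

(* Not the library's idealr_closed, which only allows proper ideals. *)
Definition is_ideal (I : set A) : Prop :=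
  [/\ I 0, forall a b, I a -> I b -> I (a + b) & forall a b, I b -> I (a * b)].

Definition ideal_gen (S : set A) : set A := smallest is_ideal S.

Definition ideal_power (I : set A) (r : nat) : set A :=
  ideal_gen [set a | exists f : 'I_r -> A,
                       (forall i, I (f i)) /\ a = \prod_(i < r) f i].

Definition prime_ideal (P : set A) : Prop :=
  [/\ is_ideal P, ~ P 1 & forall a b, P (a * b) -> P a \/ P b].

(* Ass(I), that is, the primes of the form (I : f). *)
Definition associated_primes (I : set A) : set (set A) :=
  [set P | prime_ideal P /\ exists f : A, P = [set g | I (g * f)]].

Definition symbolic_power (I : set A) (m : nat) : set A :=
  \bigcap_(P in associated_primes I) ideal_power P m.

Definition resurgence (R : realType) (I : set A) : \bar R :=
  ereal_sup [set x : \bar R | exists m r : nat,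
    [/\ (0 < m)%N, (0 < r)%N, ~ (symbolic_power I m `<=` ideal_power I r)
      & x = (m%:R / r%:R)%:E]].

End Ideals.

Definition steiner_system (V : finType) (t n v : nat) (B : {set {set V}}) : Prop :=
  [/\ #|V| = v,
      forall b : {set V}, b \in B -> #|b| = n
    & forall T : {set V}, #|T| = t ->
        exists! b : {set V}, b \in B /\ T \subset b].

Section Hyperplanes.
Variables (k : fieldType) (n : nat).

(* Points of P^n over k are the lines of k^(n+1) through the origin. *)
Definition proj_space : set {vspace 'rV[k]_n.+1} := [set L | \dim L = 1%N].

Definition zero_locus (l : mpoly n.+1 k) : set {vspace 'rV[k]_n.+1} :=
  [set L | proj_space L /\
           forall x : 'rV[k]_n.+1, x \in L -> meval (fun i => x 0 i) l = 0].

Definition defines_hyperplane (l : mpoly n.+1 k)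
    (H : set {vspace 'rV[k]_n.+1}) : Prop :=
  [/\ l \is ishomog1 1 (mdeg : measure n.+1), l != 0 & H = zero_locus l].

Variable V : finType.

Definition point_ideal (l : V -> mpoly n.+1 k) (s : {set V}) :
    set (mpoly n.+1 k) :=
  ideal_gen [set l i | i in [set` s]].

Definition complement_ideal (l : V -> mpoly n.+1 k) (B : {set {set V}}) :
    set (mpoly n.+1 k) :=
  \bigcap_(s in [set s : {set V} | #|s| = n /\ s \notin B]) point_ideal l s.

End Hyperplanes.

(* Main.v *)
(* The blocks of S(t,n,v) meet pairwise in at most t - 1 <= n - 2 points, so the
   n-subsets outside B are the bases of a (sparse paving) matroid M, and
   I^(m) lies in the intersection of the I_s^m over the bases s.

   That intersection is generated by the monomials l^a in the linear forms with
   a(s) >= m for every basis s, where a(s) is the sum of a_i for i in s.  To see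
   it, allow thresholds m - c(s) and take a non-loop u minimizing c.  Modulo l_u
   one is reduced to the contraction M/u, one rank lower; by basis exchange and
   the minimality of c_u the monomials found there satisfy all the original
   inequalities.  Subtracting them leaves a multiple of l_u, and one divides by
   l_u and increases c_u.  The division is possible because any n + 1 of the
   forms are coordinates, in which the ideals I_s^j become monomial.

   Now let l^a be such a monomial.  Products of at least v - n + 1 distinct forms
   lie in I, and so does the product of the forms outside a block.  If
   m/r >= 2 - 1/n and m/r >= n(v - n + 1)/v, then either a_i >= r off some block,
   or the truncated exponents min(a_i, r) have sum at least r(v - n + 1) and split
   into r indicator vectors of sets with at least v - n + 1 elements.  In both
   cases l^a is in I^r.  Both ratios are smaller than n. *)
Require Import Defs.
From mathcomp Require Import all_boot all_order all_algebra.
From mathcomp Require Import classical_sets reals ereal.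
From mathcomp Require Import -(notations) mpoly.
From mathcomp Require Import zify.

Set Implicit Arguments.
Unset Strict Implicit.
Unset Printing Implicit Defensive.

Import Order.TTheory GRing.Theory Num.Theory.

Local Open Scope classical_set_scope.
Local Open Scope ring_scope.

(** * Ideals *)

Section IdealFacts.
Variable A : comNzRingType.
Implicit Types (I J S : set A) (a b : A).

Lemma ideal_gen_ideal S : is_ideal (ideal_gen S).
Proof.
split.
- by move=> J [[J0 _ _] _].
- by move=> a b Sa Sb J HJ; have [[_ JD _] _] := HJ; apply: JD; [exact: Sa | exact: Sb].
- by move=> a b Sb J HJ; have [[_ _ JM] _] := HJ; apply: JM; exact: Sb.
Qed.

Lemma ideal_gen_sub S J : is_ideal J -> S `<=` J -> ideal_gen S `<=` J.
Proof. by move=> iJ SJ a; apply. Qed.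

Lemma sub_ideal_gen S : S `<=` ideal_gen S.
Proof. by move=> a Sa J [_]; apply. Qed.

Lemma ideal_genS S T : S `<=` T -> ideal_gen S `<=` ideal_gen T.
Proof.
move=> ST; apply: ideal_gen_sub; first exact: ideal_gen_ideal.
by apply: classical_sets.subset_trans ST _; exact: sub_ideal_gen.
Qed.

Lemma ideal_sum (K : Type) (s : seq K) (P : pred K) (F : K -> A) I :
  is_ideal I -> (forall i, P i -> I (F i)) -> I (\sum_(i <- s | P i) F i).
Proof. by case=> I0 ID _ IF; apply: (big_ind I). Qed.

Lemma idealN I a : is_ideal I -> I a -> I (- a).
Proof. by case=> _ _ IM Ia; rewrite -mulN1r; exact: IM. Qed.

Lemma idealB I a b : is_ideal I -> I a -> I b -> I (a - b).
Proof. by move=> iI Ia Ib; have [_ ID _] := iI; apply: ID => //; exact: idealN. Qed.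

(** The colon ideal of [I] by [b]: it allows claims about [b * x], for [x] in a generated ideal, to
    be checked on generators only. *)
Lemma mul_preimage_ideal I b : is_ideal I -> is_ideal [set a | I (b * a)].
Proof.
case=> I0 ID IM; split=> /=.
- by rewrite mulr0.
- by move=> a c; rewrite mulrDr; exact: ID.
- by move=> a c; rewrite mulrCA; exact: IM.
Qed.

End IdealFacts.

(** * Ideals generated by products of given elements *)

Section MonomialIdeals.
Variables (A : comNzRingType) (V : finType) (l : V -> A).
Implicit Types (a b c : V -> nat) (s : {set V}) (X Y : set (V -> nat)).

Definition monomial a : A := \prod_i l i ^+ a i.

Definition monomial_ideal X : set A := ideal_gen [set monomial a | a in X].

Definition weight a s : nat := \sum_(i in s) a i.

Definition unit_exp (u : V) : V -> nat := fun i => (i == u) : nat.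

Definition add_exp a b : V -> nat := fun i => (a i + b i)%N.

Lemma monomial_ideal_ideal X : is_ideal (monomial_ideal X).
Proof. exact: ideal_gen_ideal. Qed.

Lemma monomial_idealS X Y : X `<=` Y -> monomial_ideal X `<=` monomial_ideal Y.
Proof.
by move=> XY; apply: ideal_genS => _ [a Xa <-]; exists a => //; exact: XY.
Qed.

Lemma in_monomial_ideal X a : X a -> monomial_ideal X (monomial a).
Proof. by move=> Xa; apply: sub_ideal_gen; exists a. Qed.

Lemma monomial0 : monomial (fun=> 0%N) = 1.
Proof. by rewrite /monomial big1. Qed.

Lemma monomialD a b : monomial (add_exp a b) = monomial a * monomial b.
Proof. by rewrite /monomial -big_split /=; apply: eq_bigr => i _; rewrite exprD. Qed.

Lemma eq_monomial a b : a =1 b -> monomial a = monomial b.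
Proof. by move=> ab; apply: eq_bigr => i _; rewrite ab. Qed.

Lemma monomial_unit u : monomial (unit_exp u) = l u.
Proof.
rewrite /monomial (bigD1 u) //= /unit_exp eqxx expr1 big1 ?mulr1 // => i iu.
by rewrite (negPf iu).
Qed.

Lemma monomial_le a b : (forall i, a i <= b i)%N ->
  exists f, monomial b = f * monomial a.
Proof.
move=> ab; exists (monomial (fun i => b i - a i)%N); rewrite -monomialD.
by apply: eq_monomial => i; rewrite /add_exp subnK.
Qed.

Lemma monomial_ideal1 X : X (fun=> 0%N) -> forall f, monomial_ideal X f.
Proof.
move=> X0 f; have [_ _ IM] := monomial_ideal_ideal X.
by rewrite -[f]mulr1; apply: IM; rewrite -monomial0; exact: in_monomial_ideal.
Qed.

Lemma weightD a b s : weight (add_exp a b) s = (weight a s + weight b s)%N.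
Proof. by rewrite /weight -big_split. Qed.

Lemma weight_unit u s : weight (unit_exp u) s = (u \in s).
Proof.
rewrite /weight /unit_exp; have [us|us] := boolP (u \in s).
  by rewrite (bigD1 u) //= eqxx big1 // => i /andP[_ /negPf->].
by rewrite big1 // => i si; case: eqP => // iu; rewrite -iu si in us.
Qed.

Lemma weight_gt0P a s : reflect (exists2 i, i \in s & (0 < a i)%N) (0 < weight a s)%N.
Proof.
apply: (iffP idP) => [|[i si ai]]; last by rewrite /weight (bigD1 i) //= addn_gt0 ai.
rewrite lt0n sum_nat_eq0 negb_forall => /existsP[i].
by rewrite negb_imply -lt0n => /andP[]; exists i.
Qed.

Lemma weightS a s s' : s \subset s' -> (weight a s <= weight a s')%N.
Proof.
move=> ss'; rewrite /weight [leqRHS](bigID (mem s)) /=.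
rewrite [X in (_ <= X + _)%N](eq_bigl (mem s)) ?leq_addr //.
by move=> i /=; case: (boolP (i \in s)) => [/(fintype.subsetP ss')->|]; rewrite ?andbF.
Qed.

Lemma weight_swap a s u i : i \in s -> u \notin s ->
  (weight a (u |: (s :\ i)) + a i = weight a s + a u)%N.
Proof.
move=> si us; rewrite /weight big_setU1 /=; last by rewrite !inE (negPf us) andbF.
by rewrite [in RHS](big_setD1 i) //=; lia.
Qed.

Lemma weight_swap_le a s u i : i \in s -> u \notin s -> (a u <= a i)%N ->
  (weight a (u |: (s :\ i)) <= weight a s)%N.
Proof. by move=> si us ui; rewrite -(leq_add2r (a i)) weight_swap // leq_add2l. Qed.

Lemma weight_max a s x : (forall i, i \in s -> a i <= x)%N -> (weight a s <= #|s| * x)%N.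
Proof. by move=> ax; rewrite -sum_nat_const; exact: leq_sum. Qed.

Lemma weight_min a s x : (forall i, i \in s -> x <= a i)%N -> (#|s| * x <= weight a s)%N.
Proof. by move=> ax; rewrite -sum_nat_const; exact: leq_sum. Qed.

Lemma weight_setID a s s' :
  weight a s = (weight a (s :&: s') + weight a (s :\: s'))%N.
Proof. by rewrite /weight (big_setID s'). Qed.

End MonomialIdeals.

Arguments monomial_ideal_ideal {A V l X}.
Arguments unit_exp {V}.

(* Basis exchange in its dual form: the incoming element u is prescribed. *)
Definition exchange (V : finType) (M : {set {set V}}) : Prop :=
  forall s s' u, s \in M -> s' \in M -> u \in s' -> u \notin s ->
    exists i, [/\ i \in s, i \notin s' & u |: (s :\ i) \in M].

(** * Intersecting powers over the bases of a matroid *)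

Section MatroidIntersection.
Variables (A : comNzRingType) (V : finType) (l : V -> A).
Variables (n : nat) (M : {set {set V}}).
Hypothesis card_basis : forall s, s \in M -> #|s| = n.
Hypothesis exchM : exchange M.

(** Exponents of monomials in I_T + I_s^k, where I_T and I_s are generated by the forms indexed by
    [T] and [s]. *)
Definition order_ge (s T : {set V}) (k : nat) : set (V -> nat) :=
  [set a | (0 < weight a T)%N \/ (k <= weight a s)%N].

Hypothesis colon : forall (s T : {set V}) u k G, s \in M -> T \subset s -> u \notin T ->
  monomial_ideal l (order_ge s T k) (l u * G) ->
  monomial_ideal l (order_ge s T (k - (u \in s))) G.

(* The contraction by T: the elements of T have infinite weight, so that
   membership is tested modulo the forms indexed by T. *)
Definition jointly_ge (T : {set V}) (m : nat) (c : V -> nat) : set (V -> nat) :=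
  [set a | (0 < weight a T)%N \/
           forall s, s \in M -> T \subset s -> (m <= weight a s + weight c s)%N].

(** A generator divisible by [l u] goes into [G]. Otherwise [a u = 0], and a basis s avoiding [u] is
    exchanged for s - i + u, which contains [u |: T]; as [c u <= c i], its weight under a + c is at
    most that of s, so the inequality at s follows. *)
Lemma contraction_lift (T : {set V}) m c u : u \notin T ->
  (exists s, [/\ s \in M, T \subset s & u \in s]) ->
  (forall i s, s \in M -> T \subset s -> i \in s -> i \notin T -> (c u <= c i)%N) ->
  forall F, monomial_ideal l (jointly_ge (u |: T) m c) F ->
  exists F1 G, F = F1 + l u * G /\ monomial_ideal l (jointly_ge T m c) F1.
Proof.
move=> uT [s0 [s0M Ts0 us0]] cmin.
have iZ := @monomial_ideal_ideal _ _ l (jointly_ge T m c).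
apply: ideal_gen_sub; first have [Z0 ZD ZM] := iZ.
  split.
  - by exists 0, 0; rewrite mulr0 addr0.
  - move=> _ _ [F1 [G1 [-> ZF1]]] [F2 [G2 [-> ZF2]]].
    by exists (F1 + F2), (G1 + G2); rewrite mulrDr addrACA; split => //; exact: ZD.
  - move=> a _ [F1 [G1 [-> ZF1]]].
    by exists (a * F1), (a * G1); rewrite mulrDr (mulrCA a); split => //; exact: ZM.
move=> _ [a Ya <-]; case: (posnP (a u)) => [au0|au_gt0]; last first.
  have [|f ->] := @monomial_le _ _ l (unit_exp u) a.
    by move=> i; rewrite /unit_exp; case: eqP => // ->.
  exists 0, f; split; first by rewrite monomial_unit add0r mulrC.
  by have [] := iZ.
exists (monomial l a), 0; split; first by rewrite mulr0 addr0.
apply: in_monomial_ideal; case: Ya => [/weight_gt0P[i]|ge_m].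
  rewrite !inE => /orP[/eqP->|Ti ai]; first by rewrite au0.
  by left; apply/weight_gt0P; exists i.
right=> s sM Ts; have [us|us] := boolP (u \in s).
  by apply: ge_m => //; rewrite finset.subUset finset.sub1set us.
have [i [si is0 s'M]] := exchM sM s0M us0 us.
have iT : i \notin T by apply: contra is0; exact: (fintype.subsetP Ts0).
have Ts' : u |: T \subset u |: (s :\ i).
  by rewrite finset.setUS // finset.subsetD1 Ts iT.
rewrite -weightD; apply: leq_trans (ge_m _ s'M Ts') _; rewrite -weightD.
apply: weight_swap_le => //.
by rewrite /add_exp au0 add0n (leq_trans (cmin _ _ sM Ts si iT)) // leq_addl.
Qed.

Lemma jointly_order_ge (T : {set V}) m c s : s \in M -> T \subset s ->
  jointly_ge T m c `<=` order_ge s T (m - weight c s).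
Proof. by move=> sM Ts a [|/(_ _ sM Ts)]; [left|right; rewrite leq_subLR addnC]. Qed.

(** Outer induction on the rank [d] of the contraction by [T], inner induction on the sum of the
    thresholds [m - weight c s] over the bases containing [T]. *)
Lemma monomial_bigcap d (T : {set V}) m c F : (#|T| + d = n)%N ->
  (forall s, s \in M -> T \subset s ->
     monomial_ideal l (order_ge s T (m - weight c s)) F) ->
  monomial_ideal l (jointly_ge T m c) F.
Proof.
elim: d T c F => [|d IHd] T c F cardT.
  move=> HF; have [/existsP[s /andP[sM Ts]]|nos] := boolP [exists s in M, T \subset s]; last first.
    apply: monomial_ideal1; right=> s sM Ts; case/negP: nos.
    by apply/existsP; exists s; rewrite sM.
  have eqT s' : s' \in M -> T \subset s' -> s' = T.
    by move=> s'M Ts'; apply/esym/eqP; rewrite eqEcard Ts' card_basis // -cardT addn0 leqnn.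
  apply: monomial_idealS (HF s sM Ts) => a [|ge_m]; first by left.
  by right=> s' s'M Ts'; rewrite (eqT s') // -(eqT s) // addnC -leq_subLR.
have [N] := ubnP (\sum_(s in M | T \subset s) (m - weight c s)).
elim: N c F => // N IHN c F; rewrite ltnS => leN HF.
(* If every threshold has dropped to zero, the monomial 1 satisfies all the inequalities. *)
have [/existsP[s0 /and3P[s0M Ts0 ltc]]|nos] :=
  boolP [exists s in M, (T \subset s) && (weight c s < m)%N]; last first.
  apply: monomial_ideal1; right=> s sM Ts; rewrite leqNgt; apply: contra nos => lt_m.
  apply/existsP; exists s; rewrite sM Ts /=.
  by apply: leq_ltn_trans lt_m; exact: leq_addl.
pose U := [pred u | (u \notin T) && [exists s in M, (T \subset s) && (u \in s)]].
have [u0 Uu0] : exists u0, U u0.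
  have /subsetPn[u0 us0 uT] : ~~ (s0 \subset T).
    by apply/negP => /subset_leq_card; rewrite card_basis // -cardT -{2}[#|T|]addn0 leq_add2l.
  by exists u0; rewrite inE uT; apply/existsP; exists s0; rewrite s0M Ts0.
have [u Uu umin] := arg_minnP c Uu0.
move: Uu; rewrite inE => /andP[uT /existsP[t0 /and3P[t0M Tt0 ut0]]].
have cmin i s : s \in M -> T \subset s -> i \in s -> i \notin T -> (c u <= c i)%N.
  move=> sM Ts si iT; apply: umin; rewrite inE iT.
  by apply/existsP; exists s; rewrite sM Ts.
(* A basis through [u] with a positive threshold, so that raising [c u] strictly lowers the sum of
   thresholds. *)
have [s1 [s1M Ts1 us1 ltc1]] :
    exists s1, [/\ s1 \in M, T \subset s1, u \in s1 & (weight c s1 < m)%N].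
  have [us0|us0] := boolP (u \in s0); first by exists s0.
  have [i [si it0 s'M]] := exchM s0M t0M ut0 us0.
  have iT : i \notin T by apply: contra it0; exact: (fintype.subsetP Tt0).
  exists (u |: (s0 :\ i)); split=> //; last 1 first.
  - by apply: leq_ltn_trans ltc; apply: weight_swap_le => //; exact: cmin Ts0 si iT.
  - by apply: fintype.subset_trans (finset.subsetUr _ _); rewrite finset.subsetD1 Ts0.
  - by rewrite !inE eqxx.
have [F1 [G [FE ZF1]]] : exists F1 G, F = F1 + l u * G /\ monomial_ideal l (jointly_ge T m c) F1.
  apply: contraction_lift => //; first by exists t0.
  apply: IHd; first by rewrite cardsU1 uT add1n addSnnS.
  move=> s sM; rewrite finset.subUset finset.sub1set => /andP[us Ts].
  apply: monomial_idealS (HF s sM Ts) => a [aT|]; [left|by right].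
  by apply: leq_trans aT _; rewrite weightS // finset.subsetUr.
have [_ ZD _] := @monomial_ideal_ideal _ _ l (jointly_ge T m c).
rewrite FE; apply: ZD => //.
(* [l u * G = F - F1] satisfies each condition separately, so [colon] yields those for [G] with
   [c u] raised by one. *)
have ZG : monomial_ideal l (jointly_ge T m (add_exp c (unit_exp u))) G.
  apply: (IHN (add_exp c (unit_exp u)) G).
    apply: leq_trans leN.
    rewrite (bigD1 s1) ?s1M //= [ltnRHS](bigD1 s1) ?s1M //=.
    rewrite -addSn leq_add //; first by rewrite weightD weight_unit us1 addn1 ltn_sub2l.
    by apply: leq_sum => s _; rewrite weightD leq_sub2l // leq_addr.
  move=> s sM Ts; rewrite weightD weight_unit subnDA; apply: colon => //.
  have -> : l u * G = F - F1 by rewrite FE addrAC subrr add0r.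
  apply: (idealB monomial_ideal_ideal (HF s sM Ts)).
  by apply: monomial_idealS ZF1; exact: jointly_order_ge.
(* The factor [l u] makes up for the unit added to [c u]. *)
pose J := [set x | monomial_ideal l (jointly_ge T m c) (l u * x)].
apply: (ideal_gen_sub (J := J) _ _ ZG); first exact/mul_preimage_ideal/monomial_ideal_ideal.
move=> _ [a Ya <-]; rewrite /J /= -monomial_unit -monomialD; apply: in_monomial_ideal.
case: Ya => [aT|ge_m]; [by left; rewrite weightD addn_gt0 aT orbT|right=> s sM Ts].
have := ge_m s sM Ts; rewrite !weightD => le_m.
by rewrite -addnA addnC -addnA.
Qed.

End MatroidIntersection.

(** * Linear coordinates *)

Lemma exists_set_between (T : finType) (A B : {set T}) d :
  A \subset B -> (#|A| <= d <= #|B|)%N ->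
  exists D : {set T}, [/\ A \subset D, D \subset B & #|D| = d].
Proof.
move=> AB /andP[Ad dB]; pose t := take (d - #|A|) (enum (B :\: A)).
have tBA i : i \in t -> i \in B :\: A by move/mem_take; rewrite mem_enum.
exists (A :|: [set x in t]); split; first exact: finset.subsetUl.
  rewrite finset.subUset AB; apply/fintype.subsetP=> i; rewrite inE => /tBA.
  by rewrite inE => /andP[].
have dis : A :&: [set x in t] = finset.set0.
  apply/setP=> i; rewrite !inE; apply/negP => /andP[Ai /tBA].
  by rewrite inE Ai.
have cB : #|B :\: A| = (#|B| - #|A|)%N by rewrite cardsDS.
rewrite cardsU dis cards0 subn0 cardsE (card_uniqP _) ?take_uniq ?enum_uniq //.
rewrite size_takel; first by rewrite subnKC.
by rewrite -cardE cB leq_sub2r.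
Qed.

Section Coordinates.
Variables (k : fieldType) (n : nat) (V : finType) (l : V -> mpoly n k).
Variables (e : 'I_n -> V) (phi psi : {lrmorphism mpoly n k -> mpoly n k}).
Hypothesis e_inj : injective e.
Hypothesis phi_l : forall i, phi (l (e i)) = mpolyX k (mnm1 i).
Hypothesis psiX : forall i, psi (mpolyX k (mnm1 i)) = l (e i).
Hypothesis phiK : cancel phi psi.

Definition push_exp (m : multinom n) : V -> nat := fun i => (\sum_(j | e j == i) m j)%N.

Lemma push_exp_in m j : push_exp m (e j) = m j.
Proof.
by rewrite /push_exp (big_pred1 j) // => i; rewrite /= (inj_eq e_inj).
Qed.

Lemma push_exp_notin m i : (forall j, e j != i) -> push_exp m i = 0%N.
Proof. by move=> ei; rewrite /push_exp big1 // => j eji; move: (ei j); rewrite eji. Qed.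

Lemma psi_mpolyX m : psi (mpolyX k m) = monomial l (push_exp m).
Proof.
rewrite mpolyXE_id rmorph_prod /monomial (partition_big e predT) //=.
apply: eq_bigr => i _; rewrite /push_exp -prodrXr.
by apply: eq_bigr => j /eqP <-; rewrite rmorphXn /= psiX.
Qed.

(** Such an [X] is upward closed and ignores indices outside the image of [e]. *)
Definition stable_exps (X : set (V -> nat)) : Prop :=
  forall a b, (forall j, a (e j) <= b (e j))%N -> X a -> X b.

(** [phi] carries the ideal to a true monomial ideal in the variables: by stability, the factors of
    a generator outside the image of [e] may be dropped. *)
Lemma monomial_ideal_coord (X : set (V -> nat)) G : stable_exps X ->
  monomial_ideal l X G <-> (forall m, m \in msupp (phi G) -> X (push_exp m)).
Proof.
move=> stX; split; last first.
  move=> HG; rewrite -[G]phiK [phi G]mpolyE raddf_sum /= big_seq.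
  apply: ideal_sum; first exact: monomial_ideal_ideal.
  move=> m /HG Xm; rewrite linearZ /= psi_mpolyX -mul_mpolyC.
  have [_ _ IM] := @monomial_ideal_ideal _ _ l X.
  by apply: IM; exact: in_monomial_ideal.
pose J := [set g | forall m, m \in msupp (phi g) -> X (push_exp m)].
suff: monomial_ideal l X `<=` J by apply.
apply: ideal_gen_sub.
  split.
  - by move=> m; rewrite rmorph0 msupp0.
  - move=> f g Jf Jg m; rewrite rmorphD => /msuppD_le.
    by rewrite mem_cat => /orP[/Jf|/Jg].
  - move=> f g Jg m; rewrite rmorphM => /msuppM_le /allpairsP[[m1 m2] /= [_ m2g ->]].
    apply: stX (Jg _ m2g) => j.
    by rewrite !push_exp_in mnmDE leq_addl.
move=> _ [a Xa <-] m.
pose ma := Multinom [tuple a (e i) | i < n].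
have maE j : ma j = a (e j) by rewrite /ma mnmE.
have [|f ->] := @monomial_le _ _ l (push_exp ma) a.
  move=> i; have [/existsP[j /eqP <-]|] := boolP [exists j, e j == i].
    by rewrite push_exp_in maE.
  by rewrite negb_exists => /forallP ei; rewrite push_exp_notin.
have phi_ma : phi (monomial l (push_exp ma)) = mpolyX k ma.
  rewrite -psi_mpolyX mpolyXE_id !rmorph_prod; apply: eq_bigr => i _.
  by rewrite !rmorphXn /= psiX phi_l.
rewrite rmorphM /= phi_ma => /msuppM_le /allpairsP[[m1 m2] /= [_]].
rewrite msuppX inE => /eqP -> ->; apply: stX Xa => j.
by rewrite push_exp_in mnmDE maE leq_addl.
Qed.

Lemma weight_push_expD m j s :
  weight (push_exp (mnm_add m (mnm1 j))) s = (weight (push_exp m) s + (e j \in s))%N.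
Proof.
rewrite -weight_unit -weightD; apply: eq_bigr => i _.
rewrite /add_exp /push_exp /unit_exp (eq_bigr (fun h => m h + (j == h))%N).
  rewrite big_split /=; congr (_ + _)%N.
  have [->|eji] := eqVneq i (e j).
    by rewrite (big_pred1 j) ?eqxx // => h; rewrite /= (inj_eq e_inj).
  by rewrite big1 // => h /eqP ehi; case: eqP => // jh; rewrite jh ehi eqxx in eji.
by move=> h _; rewrite mnmDE mnm1E.
Qed.

Lemma stable_weight (s : {set V}) a b : (forall i, i \in s -> exists j, e j = i) ->
  (forall j, a (e j) <= b (e j))%N -> (weight a s <= weight b s)%N.
Proof. by move=> es ab; apply: leq_sum => i /es[j <-]. Qed.

Lemma stable_order_ge (s T : {set V}) d : (forall i, i \in s -> exists j, e j = i) ->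
  T \subset s -> stable_exps (order_ge s T d).
Proof.
move=> es Ts a b ab [aT|da]; [left; apply: leq_trans aT _|right; apply: leq_trans da _].
  by apply: stable_weight => // i /(fintype.subsetP Ts); exact: es.
exact: stable_weight.
Qed.

(** In coordinates, multiplying by [l (e j)] shifts the support by [mnm1 j], which keeps the weight
    on [T] and raises that on [s] exactly when [e j] lies in [s]. *)
Lemma coord_colon (s T : {set V}) d j G :
  (forall i, i \in s -> exists j, e j = i) -> T \subset s -> e j \notin T ->
  monomial_ideal l (order_ge s T d) (l (e j) * G) ->
  monomial_ideal l (order_ge s T (d - (e j \in s))) G.
Proof.
move=> es Ts ejT /(monomial_ideal_coord _ (stable_order_ge (d:=d) es Ts)) HG.
apply/monomial_ideal_coord; first exact: stable_order_ge.
move=> m mG; have := HG (mnm_add m (mnm1 j)).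
rewrite rmorphM /= phi_l mulrC mcoeff_msupp [in mcoeff _ _]addmC mcoeffMX -mcoeff_msupp.
move=> /(_ mG); rewrite /order_ge /= !weight_push_expD.
by rewrite (negPf ejT) addn0 leq_subLR addnC.
Qed.

Let vanish (s : {set V}) : mpoly n k -> mpoly n k :=
  comp_mpoly [tuple if e j \in s then 0 else mpolyX k (mnm1 j) | j < n].

Lemma vanish_mpolyX s m : vanish s (mpolyX k m) =
  if (0 < weight (push_exp m) s)%N then 0 else mpolyX k m.
Proof.
rewrite /vanish comp_mpolyX [in RHS]mpolyXE_id; case: weight_gt0P => [[i si]|noi].
  have [/existsP[j /eqP eji]|] := boolP [exists j, e j == i]; last first.
    by rewrite negb_exists => /forallP ei; rewrite push_exp_notin.
  rewrite -eji push_exp_in => mj; rewrite (bigD1 j) //= tnth_mktuple eji si.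
  by rewrite expr0n eqn0Ngt mj mul0r.
apply: eq_bigr => j _; rewrite tnth_mktuple; case: ifP => // ejs.
have [->|mj] := posnP (m j); first by rewrite !expr0.
by case: noi; exists (e j) => //; rewrite push_exp_in.
Qed.

(** The ideal is the kernel of [kap], which kills the forms in [s] and fixes the other coordinates;
    the polynomial ring is a domain. *)
Lemma prime_coord (s : {set V}) : (forall i, i \in s -> exists j, e j = i) ->
  prime_ideal (monomial_ideal l [set a | (0 < weight a s)%N]).
Proof.
move=> es; set X := [set a | _].
have iX := @monomial_ideal_ideal _ _ l X; have [_ _ XM] := iX.
pose kap : {rmorphism mpoly n k -> mpoly n k} := psi \o (vanish s \o phi).
have kapX f : monomial_ideal l X f -> kap f = 0.
  pose J := [set g | kap g = 0].
  suff: monomial_ideal l X `<=` J by apply.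
  move=> {f}; apply: ideal_gen_sub.
    split; first exact: (rmorph0 kap).
    - by move=> a b; rewrite /J /mkset => ka kb; rewrite (rmorphD kap) ka kb addr0.
    - by move=> a b; rewrite /J /mkset => kb; rewrite (rmorphM kap) kb mulr0.
  move=> _ [a /weight_gt0P[i si ai] <-]; rewrite /J /mkset.
  have [|f ->] := @monomial_le _ _ l (unit_exp i) a.
    by move=> j; rewrite /unit_exp; case: eqP => // ->.
  have [j eji] := es i si.
  rewrite monomial_unit (rmorphM kap) -eji; apply/eqP; rewrite mulf_eq0; apply/orP; right.
  rewrite /kap /= phi_l /vanish comp_mpolyXU -tnth_nth tnth_mktuple eji si.
  by rewrite rmorph0.
have kapB f : monomial_ideal l X (f - kap f).
  rewrite -{1}[f]phiK /kap /= -rmorphB; set g := phi f.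
  rewrite {1 2}[g]mpolyE /vanish (raddf_sum (comp_mpoly _)) -sumrB raddf_sum /=.
  apply: ideal_sum => // m _; rewrite linearZ /= -scalerBr linearZ /= -mul_mpolyC; apply: XM.
  rewrite -/(vanish s _) vanish_mpolyX; case: ifP => [m_gt0|_].
    by rewrite subr0 psi_mpolyX; exact: in_monomial_ideal.
  by rewrite subrr rmorph0; have [] := iX.
split=> //.
  by move/kapX => /eqP; rewrite rmorph1 oner_eq0.
move=> f g /kapX; rewrite rmorphM => /eqP; rewrite mulf_eq0.
move=> /orP[]/eqP k0; [left|right].
- by have := kapB f; rewrite k0 subr0.
- by have := kapB g; rewrite k0 subr0.
Qed.
End Coordinates.

Lemma linear_formE (k : fieldType) n (p : mpoly n k) :
  p \is ishomog1 1 (mdeg : measure n) ->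
  p = \sum_i mcoeff (mnm1 i) p *: mpolyX k (mnm1 i).
Proof.
move=> hp; apply/mpolyP => m; rewrite raddf_sum /=.
under eq_bigr => i _ do rewrite mcoeffZ mcoeffX.
have [/mdeg1P[i /eqP ->]|m1] := boolP (mdeg m == 1%N).
  rewrite (bigD1 i) //= eqxx mulr1 big1 ?addr0 // => j ji.
  by rewrite eq_mnm1 (negPf ji) mulr0.
rewrite (dhomog_nemf_coeff hp m1) big1 // => i _.
case: eqP => [mi|_]; last by rewrite mulr0.
by rewrite -mi mdeg1 in m1.
Qed.

(** The coefficient matrix [M] is invertible because its kernel consists of common zeros; [psi]
    substitutes the forms for the variables, [phi] the rows of the inverse matrix. *)
Lemma linear_coordinates (k : fieldType) n (f : 'I_n -> mpoly n k) :
  (forall i, f i \is ishomog1 1 (mdeg : measure n)) ->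
  (forall x : 'rV[k]_n, (forall i, meval (fun j => x 0 j) (f i) = 0) -> x = 0) ->
  exists phi psi : {lrmorphism mpoly n k -> mpoly n k},
    [/\ forall i, phi (f i) = mpolyX k (mnm1 i),
        forall i, psi (mpolyX k (mnm1 i)) = f i & cancel phi psi].
Proof.
move=> fhom fnz; pose M : 'M[k]_n := \matrix_(i, j) mcoeff (mnm1 j) (f i).
have fE i : f i = \sum_j M i j *: mpolyX k (mnm1 j).
  by rewrite {1}(linear_formE (fhom i)); apply: eq_bigr => j _; rewrite mxE.
have Mu : M \in unitmx.
  rewrite -unitmx_tr unitmxE unitfE; apply/det0P => -[x xn0 xM].
  case/eqP: xn0; apply: fnz => i; rewrite fE raddf_sum /=.
  have /rowP/(_ i) := xM; rewrite !mxE => xMi; rewrite -[RHS]xMi; apply: eq_bigr => j _.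
  by rewrite mevalZ mevalXU !mxE mulrC.
pose phi : {lrmorphism mpoly n k -> mpoly n k} :=
  comp_mpoly [tuple \sum_i invmx M j i *: mpolyX k (mnm1 i) | j < n].
pose psi : {lrmorphism mpoly n k -> mpoly n k} := comp_mpoly [tuple f i | i < n].
have phiX j : phi (mpolyX k (mnm1 j)) = \sum_i invmx M j i *: mpolyX k (mnm1 i).
  by rewrite /phi /= comp_mpolyXU -tnth_nth tnth_mktuple.
have psiX i : psi (mpolyX k (mnm1 i)) = f i.
  by rewrite /psi /= comp_mpolyXU -tnth_nth tnth_mktuple.
clearbody phi psi.
have sumM (P Q : 'M[k]_n) (g : 'I_n -> mpoly n k) i : P *m Q = 1%:M ->
    \sum_j P i j *: \sum_h Q j h *: g h = g i.
  move=> PQ; under eq_bigr => j _ do rewrite scaler_sumr.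
  rewrite exchange_big /= (bigD1 i) //= [X in _ + X]big1 => [|h hi]; rewrite ?addr0.
    under eq_bigr => j _ do rewrite scalerA.
    by rewrite -scaler_suml; have /matrixP/(_ i i) := PQ; rewrite !mxE eqxx => ->; rewrite scale1r.
  under eq_bigr => j _ do rewrite scalerA.
  rewrite -scaler_suml; have /matrixP/(_ i h) := PQ; rewrite !mxE eq_sym (negPf hi) => ->.
  by rewrite scale0r.
exists phi, psi; split=> //.
  move=> i; rewrite fE raddf_sum /=; under eq_bigr => j _ do rewrite linearZ /= phiX.
  by rewrite sumM // mulmxV.
move=> p; rewrite [RHS]mpolyE {1}[p]mpolyE (raddf_sum phi) (raddf_sum psi).
apply: eq_bigr => m _; rewrite /= linearZ /= linearZ /=.
congr (_ *: _); rewrite mpolyXE_id (rmorph_prod phi) (rmorph_prod psi); apply: eq_bigr => j _.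
rewrite (rmorphXn phi) (rmorphXn psi) /= phiX raddf_sum /=; congr (_ ^+ _).
under eq_bigr => i _ do rewrite linearZ /= psiX fE.
by rewrite sumM // mulVmx.
Qed.

Definition general_position (k : fieldType) n (V : finType)
    (l : V -> mpoly n.+1 k) : Prop :=
  forall e : 'I_n.+1 -> V, injective e ->
  exists phi psi : {lrmorphism mpoly n.+1 k -> mpoly n.+1 k},
    [/\ forall i, phi (l (e i)) = mpolyX k (mnm1 i),
        forall i, psi (mpolyX k (mnm1 i)) = l (e i) & cancel phi psi].

(** * Point ideals and the symbolic powers of their intersection *)

Section PointIdeals.
Variables (A : comNzRingType) (V : finType) (l : V -> A).

Definition weight_ge (s : {set V}) (m : nat) : set (V -> nat) :=
  [set a | (m <= weight a s)%N].

Lemma order_ge0 s m : order_ge s finset.set0 m = weight_ge s m.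
Proof.
apply/seteqP; split=> a; last by right.
by case=> //; rewrite /weight big_set0.
Qed.

Lemma monomial_idealM X Y Z f g : (forall a b, X a -> Y b -> Z (add_exp a b)) ->
  monomial_ideal l X f -> monomial_ideal l Y g -> monomial_ideal l Z (f * g).
Proof.
move=> XYZ Xf Yg; have iZ := @monomial_ideal_ideal _ _ l Z.
pose J := [set x | monomial_ideal l Z (f * x)].
apply: (ideal_gen_sub (J := J) _ _ Yg); first exact: mul_preimage_ideal.
move=> _ [b Yb <-]; rewrite /J /mkset mulrC.
pose J' := [set x | monomial_ideal l Z (monomial l b * x)].
apply: (ideal_gen_sub (J := J') _ _ Xf); first exact: mul_preimage_ideal.
move=> _ [a Xa <-]; rewrite /J' /mkset mulrC -monomialD.
by apply: in_monomial_ideal; exact: XYZ.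
Qed.

End PointIdeals.

Section Associated.
Variables (k : fieldType) (n : nat) (V : finType) (l : V -> mpoly n.+1 k).
Variable B : {set {set V}}.
Hypothesis ltnV : (n < #|V|)%N.
Hypothesis coords : general_position l.

Local Notation I := (complement_ideal l B).

Lemma point_idealE s : point_ideal l s = monomial_ideal l (weight_ge s 1).
Proof.
apply/seteqP; split; apply: ideal_gen_sub; try exact: ideal_gen_ideal.
  move=> _ [i /= si <-]; rewrite -monomial_unit; apply: in_monomial_ideal.
  by rewrite /weight_ge /mkset weight_unit si.
move=> _ [a /weight_gt0P[i si ai] <-].
have [|f ->] := @monomial_le _ _ l (unit_exp i) a.
  by move=> j; rewrite /unit_exp; case: eqP => // ->.
have [_ _ IM] := @ideal_gen_ideal _ [set l i | i in [set` s]].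
by apply: IM; rewrite monomial_unit; apply: sub_ideal_gen; exists i.
Qed.

Lemma point_ideal_power s m :
  ideal_power (point_ideal l s) m `<=` monomial_ideal l (weight_ge s m).
Proof.
apply: ideal_gen_sub; first exact: monomial_ideal_ideal.
move=> _ [f [sf ->]]; elim: m f sf => [|m IHm] f sf.
  by rewrite big_ord0 -(monomial0 l); apply: in_monomial_ideal.
rewrite big_ord_recl; apply: (@monomial_idealM _ _ _ (weight_ge s 1) (weight_ge s m)).
- by move=> a b; rewrite /weight_ge /mkset weightD -add1n; exact: leq_add.
- by rewrite -point_idealE.
- by apply: IHm => i.
Qed.

Lemma enumerate_superset (s : {set V}) : (#|s| <= n.+1)%N ->
  exists e : 'I_n.+1 -> V, injective e /\ forall i, i \in s -> exists j, e j = i.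
Proof.
move=> ls; have [|D [sD _ cD]] := exists_set_between (finset.subsetT s) (d := n.+1).
  by rewrite ls cardsT.
exists (fun j => enum_val (cast_ord (esym cD) j)); split.
  by move=> i j /enum_val_inj/cast_ord_inj.
move=> i /(fintype.subsetP sD) iD.
by exists (cast_ord cD (enum_rank_in iD i)); rewrite cast_ordK enum_rankK_in.
Qed.

Lemma point_prime (s : {set V}) : (#|s| <= n.+1)%N -> prime_ideal (point_ideal l s).
Proof.
move=> /enumerate_superset[e [e_inj es]]; have [phi [psi [phil psiX phiK]]] := coords e_inj.
by rewrite point_idealE; exact: (prime_coord e_inj phil psiX phiK es).
Qed.

(** [u |: s] has at most n + 1 elements, hence extends to a system of coordinates. *)
Lemma forms_colon (s T : {set V}) u d G : #|s| = n -> T \subset s -> u \notin T ->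
  monomial_ideal l (order_ge s T d) (l u * G) ->
  monomial_ideal l (order_ge s T (d - (u \in s))) G.
Proof.
move=> cs Ts uT.
have [|e [e_inj es]] := @enumerate_superset (u |: s).
  by rewrite cardsU1 cs; case: (u \notin s).
have [phi [psi [phil psiX phiK]]] := coords e_inj.
have [j ej] := es u (setU11 _ _); rewrite -ej in uT *.
apply: (coord_colon e_inj phil psiX phiK) => // i si.
by apply: es; rewrite !inE si orbT.
Qed.

Definition bases : {set {set V}} := finset (fun s : {set V} => (#|s| == n) && (s \notin B)).

Lemma basesP (s : {set V}) : reflect (#|s| = n /\ s \notin B) (s \in bases).
Proof. by rewrite inE; apply: (iffP andP) => [[/eqP]|[->]]. Qed.

Lemma forms_colon_prod (s : {set V}) (r : seq V) g : #|s| = n -> all [pred i | i \notin s] r ->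
  point_ideal l s (g * \prod_(i <- r) l i) -> point_ideal l s g.
Proof.
move=> cs; elim: r g => [|u r IHr] g /=; first by rewrite big_nil mulr1.
move=> /andP[us rs]; rewrite big_cons mulrCA => lg; apply: IHr => //.
move: lg; rewrite point_idealE -order_ge0 => /(forms_colon cs).
by rewrite finset.sub0set inE (negPf us) subn0; apply.
Qed.

Lemma point_associated s : s \in bases -> associated_primes I (point_ideal l s).
Proof.
move=> /basesP[cs sB]; split; first by apply: point_prime; rewrite cs.
(* The witness multiplies the forms of s' outside [s], over all other bases s': it lies in every
   other point ideal and is a nonzerodivisor modulo that of [s]. *)
pose r := flatten [seq enum (s' :\: s) | s' <- enum (bases :\ s)].
exists (\prod_(i <- r) l i); apply/seteqP; split=> g /=.
  move=> sg s' /= [cs' s'B]; have [->|ss'] := eqVneq s' s.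
    have [_ _ IM] := @ideal_gen_ideal _ [set l i | i in [set` s]].
    by rewrite mulrC; exact: IM.
  have [i] : exists i, i \in s' :\: s.
    apply/finset.set0Pn; rewrite finset.setD_eq0; apply: contra ss' => s's.
    by rewrite eqEcard s's cs cs' /=.
  move=> is'; have ir : i \in r.
    apply/flattenP; exists (enum (s' :\: s)); last by rewrite mem_enum.
    by apply: map_f; rewrite mem_enum !inE ss' cs' eqxx.
  have [_ _ IM] := @ideal_gen_ideal _ [set l i | i in [set` s']].
  rewrite (big_rem i) //= mulrCA mulrC; apply: IM; apply: sub_ideal_gen; exists i => //.
  by case/setDP: is'.
move=> Ig; apply: (@forms_colon_prod s r) => //; last by apply: Ig.
by apply/allP=> i /flattenP[_ /mapP[s' _ ->]]; rewrite mem_enum => /setDP[].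
Qed.

Hypothesis bases_exchange : exchange bases.

(** The point ideals of the bases are associated primes, so [F] lies in every I_s^m, and
    [monomial_bigcap] applies with empty [T] and zero [c]. *)
Lemma symbolic_power_monomial m :
  symbolic_power I m `<=`
  monomial_ideal l [set a | forall s, s \in bases -> (m <= weight a s)%N].
Proof.
move=> F IF; have : monomial_ideal l (jointly_ge bases finset.set0 m (fun=> 0%N)) F.
  apply: (@monomial_bigcap _ _ l n bases _ _ _ n); rewrite ?cards0 //.
  - by move=> s /basesP[].
  - by move=> s T u d G /basesP[cs _]; exact: forms_colon.
  - move=> s sM _; rewrite order_ge0 /weight big1 // subn0.
    by apply: point_ideal_power; apply: IF; exact: point_associated.
apply: monomial_idealS => a [|ge_m s sM]; first by rewrite /weight big_set0.
have := ge_m s sM (finset.sub0set _).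
by rewrite [X in (_ <= _ + X)%N](_ : _ = 0%N) ?addn0 // /weight big1.
Qed.

End Associated.

(** * Monomials in powers of an ideal *)

Section PowersOfIdeals.
Variables (A : comNzRingType) (V : finType) (l : V -> A) (J : set A).

Lemma ideal_powerS r x y : J x -> ideal_power J r y -> ideal_power J r.+1 (x * y).
Proof.
move=> Jx Jy; pose K := [set z | ideal_power J r.+1 (x * z)].
apply: (ideal_gen_sub (J := K) _ _ Jy).
  exact/mul_preimage_ideal/ideal_gen_ideal.
move=> _ [f [Jf ->]]; apply: sub_ideal_gen.
exists (fun i => oapp f x (unlift ord0 i)); split.
  by move=> i; case: unliftP => [j|] _ /=.
rewrite big_ord_recl unlift_none /=; congr (_ * _).
by apply: eq_bigr => i _; rewrite liftK.
Qed.

Lemma ideal_power0 x : ideal_power J 0 x.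
Proof.
have [_ _ IM] := @ideal_gen_ideal _ [set a | exists f : 'I_0 -> A,
                       (forall i, J (f i)) /\ a = \prod_(i < 0) f i].
rewrite -[x]mulr1; apply: IM; apply: sub_ideal_gen.
by exists (fun=> 0); split=> [[]//|]; rewrite big_ord0.
Qed.

Lemma ideal_powerX r x : J x -> ideal_power J r (x ^+ r).
Proof.
move=> Jx; elim: r => [|r IHr]; first exact: ideal_power0.
by rewrite exprS; exact: ideal_powerS.
Qed.

Definition indicator (D : {set V}) : V -> nat := fun i => (i \in D) : nat.

Lemma weight_indicator D : weight (indicator D) finset.setT = #|D|.
Proof.
rewrite /weight /indicator -sum1_card [RHS]big_mkcond.
by apply: eq_big => [i|i _]; [rewrite inE | case: (i \in D)].
Qed.

Lemma monomial_indicator D : monomial l (indicator D) = \prod_(i in D) l i.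
Proof.
rewrite /monomial /indicator [RHS]big_mkcond; apply: eq_bigr => i _.
by case: (i \in D).
Qed.

(** Induction on [r], splitting off the indicator of a set [D] inside the support. It contains every
    index with the top exponent, so that the rest obeys the smaller bound, and leaves enough
    weight. *)
Lemma monomial_in_power d r a :
  (forall D : {set V}, (d <= #|D|)%N -> J (\prod_(i in D) l i)) ->
  (forall i, a i <= r)%N -> (r * d <= weight a finset.setT)%N ->
  ideal_power J r (monomial l a).
Proof.
move=> JD; elim: r a => [|r IHr] a ar rd; first exact: ideal_power0.
suff [D [dD aD topD posD]] : exists D : {set V},
    [/\ (d <= #|D|)%N, (r * d + #|D| <= weight a finset.setT)%N,
        (forall i, a i = r.+1 -> i \in D) & (forall i, i \in D -> 0 < a i)%N].
  pose b i := (a i - indicator D i)%N.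
  have ab : a =1 add_exp (indicator D) b.
    move=> i; rewrite /add_exp /b subnKC // /indicator.
    by have := posD i; case: (i \in D) => // ->.
  rewrite (eq_monomial _ ab) monomialD monomial_indicator.
  apply: ideal_powerS; first exact: JD.
  have bD : weight a finset.setT = (#|D| + weight b finset.setT)%N.
    by rewrite -weight_indicator -weightD; apply: eq_bigr => i _; exact: ab.
  apply: IHr => [i|]; last by move: aD; rewrite bD addnC leq_add2l.
  rewrite /b /indicator; have := ar i; have := topD i.
  case: (i \in D) => [_ ai|]; first by rewrite leq_subLR add1n.
  by rewrite subn0 leq_eqVlt ltnS => ai /orP[/eqP/ai|].
pose D1 := finset (fun i => a i == r.+1); pose D0 := finset (fun i => (0 < a i)%N).
(* If at least [d] exponents equal r + 1, [D1] works: it alone has weight (r + 1) #|D1| >= r d +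
   #|D1|. *)
have [d1|d1] := leqP d #|D1|.
  exists D1; split=> //.
  - apply: leq_trans (weightS a (finset.subsetT D1)).
    apply: (@leq_trans (#|D1| * r.+1)); last by apply: weight_min => i; rewrite inE => /eqP ->.
    by rewrite mulnSr leq_add2r mulnC leq_mul2r d1 orbT.
  - by move=> i ai; rewrite inE ai.
  - by move=> i; rewrite inE => /eqP ->.
(* [D0] has at least [d] elements, since the total weight is at least (r + 1) d and at most (r + 1)
   #|D0|. *)
have [||D [D1D DD0 cD]] := @exists_set_between _ D1 D0 d.
- by apply/fintype.subsetP => i; rewrite !inE => /eqP ->.
- rewrite ltnW //= -(@leq_pmul2l r.+1) //; apply: leq_trans rd _.
  rewrite mulnC (weight_setID _ _ D0) finset.setTI addnC.
  rewrite [X in (X + _)%N](_ : _ = 0%N) ?add0n; first exact: weight_max.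
  rewrite /weight big1 // => i; rewrite !inE andbT -leqNgt leqn0.
  by move/eqP.
exists D; split.
- by rewrite cD.
- by rewrite cD -mulSnr.
- by move=> i ai; apply: (fintype.subsetP D1D); rewrite inE ai.
- by move=> i /(fintype.subsetP DD0); rewrite inE.
Qed.

End PowersOfIdeals.

(** Meant for [w] exponents with sum [W] and mean at least m/n. The last hypothesis gives W >= r w
    (v - n + 1)/v, and (w - n + 1)/w does not decrease with w. *)
Lemma mean_bound (n m r v w W : nat) : (0 < n)%N -> (n <= w <= v)%N ->
  (w * m <= n * W)%N -> (r * (n * (v - n).+1) <= m * v)%N -> (r * (w - n).+1 <= W)%N.
Proof.
move=> n0 /andP[nw wv] wm rm.
have h1 : (w * (r * (n * (v - n).+1)) <= w * (m * v))%N by rewrite leq_mul2l rm orbT.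
have h2 : (w * m * v <= n * W * v)%N by rewrite leq_mul2r wm orbT.
have h3 : (w * (r * (v - n).+1) <= v * W)%N.
  rewrite -(leq_pmul2l n0); apply: leq_trans (leq_trans h2 _); lia.
have h4 : (v * (w - n).+1 <= w * (v - n).+1)%N.
  rewrite -(subnK nw) -(subnK (leq_trans nw wv)) !addnK.
  have : (w - n <= v - n)%N by rewrite leq_sub2r.
  move: (w - n)%N (v - n)%N => p q pq; nia.
rewrite -(@leq_pmul2l v); last by apply: leq_trans n0 (leq_trans nw wv).
apply: leq_trans h3; rewrite mulnCA [leqRHS]mulnCA leq_mul2l h4 orbT //.
Qed.

(** [S] is the weight of a block made of the n smallest exponents, [x] the least of the [p] others;
    the third hypothesis adds up the bounds for the n bases obtained by one swap. For p = 1 the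
    ratio 2 - 1/n is just enough; for p >= 2 the mean is at least m/n. *)
Lemma block_bound (n m r p x S : nat) : (2 <= n)%N -> (0 < p)%N ->
  (n * m + S <= n * (S + x))%N -> (S <= n * x)%N -> (x <= r)%N -> (r * (2 * n - 1) <= m * n)%N ->
  (r * p.+1 <= S + p * x)%N \/ ((n + p) * m <= n * (S + p * x))%N.
Proof.
case: n => // n; rewrite ltnS => n0; case: p => // p _ le_m le_S xr rm.
have n1 : (2 * n.+1 - 1 = n.*2.+1)%N by lia.
rewrite {}n1 in rm.
case: p => [|p]; [left|right].
  rewrite -(@leq_pmul2l n) //; nia.
have mx : (m <= n.+1 * x)%N by rewrite -(@leq_pmul2l n.+1) //; nia.
rewrite -(@leq_pmul2l n) //.
have h1 : (n.+1 * m + n * (p.+2 * x) <= n * (S + p.+2 * x) + n.+1 * x)%N by nia.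
(* In the original n and p: (n - 1) p - n, the factor applied to m <= n x, is nonnegative because n
   and p are at least 2. *)
have h2 : (n * p.+2 = (n.+1 + (n.-1 + n * p)))%N by nia.
have h3 : ((n.-1 + n * p) * m <= (n.-1 + n * p) * (n.+1 * x))%N by rewrite leq_mul2l mx orbT.
nia.
Qed.

(** * Exponents on a sparse paving matroid *)

Section SparsePaving.
Variables (V : finType) (n : nat) (B : {set {set V}}).
Hypothesis card_block : forall b, b \in B -> #|b| = n.
Hypothesis sparse : forall b b', b \in B -> b' \in B ->
  (n.-1 <= #|b :&: b'|)%N -> b = b'.

(** The new set shares n - 1 elements with [b], which two distinct blocks cannot. *)
Lemma swap_notin_blocks (b : {set V}) i j : b \in B -> i \in b -> j \notin b ->
  j |: (b :\ i) \notin B.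
Proof.
move=> bB ib jb; apply/negP => b'B.
have bb' : (n.-1 <= #|b :&: (j |: (b :\ i))|)%N.
  rewrite -(card_block bB) (cardsD1 i) ib add1n /=; apply: subset_leq_card.
  by apply/fintype.subsetP => h; rewrite !inE => /andP[-> ->]; rewrite orbT.
by move: jb; rewrite (sparse bB b'B bb') !inE eqxx.
Qed.

(** For i in s but not in s', the set s - i + u fails only if it is a block. It then differs from
    s', so a second such element j exists, and s - j + u is one swap away from that block. *)
Lemma exchange_bases : exchange (bases n B).
Proof.
move=> s s' u /basesP[cs sB] /basesP[cs' s'B] us' us.
have card_swap i : i \in s -> #|u |: (s :\ i)| = n.
  by move=> si; rewrite cardsU1 !inE (negPf us) andbF /= -cs (cardsD1 i s) si.
have [i] : exists i, i \in s :\: s'.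
  apply/finset.set0Pn; rewrite finset.setD_eq0; apply: contra us => ss'.
  suff -> : s = s' by [].
  by apply/eqP; rewrite eqEcard ss' cs cs' leqnn.
move=> /setDP[si is'].
have [siB|siB] := boolP (u |: (s :\ i) \in B); last first.
  by exists i; split=> //; apply/basesP; split=> //; exact: card_swap.
have [|[j]] := set_0Vmem (s :\: s' :\ i).
  move=> s0; suff e : u |: (s :\ i) = s' by rewrite e (negPf s'B) in siB.
  apply/eqP; rewrite eqEcard card_swap // cs' leqnn andbT.
  apply/fintype.subsetP => h; rewrite !inE => /orP[/eqP->//|/andP[hi hs]].
  by have /setP/(_ h) := s0; rewrite !inE hi hs andbT => /negbFE.
rewrite !inE => /and3P[ji js' js]; exists j; split=> //.
apply/basesP; split; first exact: card_swap.
(* [s - j + u] and [s - i + u] differ by one swap. *)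
have -> : u |: (s :\ j) = i |: ((u |: (s :\ i)) :\ j).
  apply/setP => h; rewrite !inE; have [->|hi] := eqVneq h i.
    by rewrite si (eq_sym i j) ji orbT.
  have [->|hj] := eqVneq h j; rewrite ?andbF ?andbT //=.
  by rewrite orbF; apply/eqP => ju; rewrite -ju js in us.
apply: swap_notin_blocks => //; rewrite !inE ?ji ?js ?orbT // eqxx /= orbF.
by apply/eqP => iu; rewrite -iu si in us.
Qed.

(** With [T] the indices where a_i < r, the truncated weight is a(T) + r (v - #|T|). If #|T| >= n,
    either [T] is a block or a(T) >= r (#|T| - n + 1); this is seen from an n-subset [s] of [T] of
    least weight. *)
Lemma truncated_weight m r a : (2 <= n)%N -> (n < #|V|)%N ->
  (forall s, s \in bases n B -> (m <= weight a s)%N) ->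
  (r * (2 * n - 1) <= m * n)%N -> (r * (n * (#|V| - n).+1) <= m * #|V|)%N ->
  (exists2 b, b \in B & forall i, i \notin b -> (r <= a i)%N) \/
  (r * (#|V| - n).+1 <= weight (fun i => minn (a i) r) finset.setT)%N.
Proof.
move=> n2 nV am rm1 rm2; pose T := finset (fun i => (a i < r)%N).
have wT : weight (fun i => minn (a i) r) finset.setT = (weight a T + r * (#|V| - #|T|))%N.
  rewrite (weight_setID _ _ T) finset.setTI finset.setTD; congr (_ + _)%N.
    by apply: eq_bigr => i; rewrite inE => ai; apply/minn_idPl; exact: ltnW.
  have <- : #|~: T| = (#|V| - #|T|)%N by rewrite cardsCs finset.setCK.
  rewrite mulnC -sum_nat_const; apply: eq_bigr => i.
  by rewrite !inE -leqNgt => /minn_idPr.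
have wV : (#|T| <= #|V|)%N := max_card _.
have [Tn|nT] := ltnP #|T| n.
  right; rewrite wT; apply: leq_trans (leq_addl _ _); rewrite leq_mul2l; apply/orP; right.
  by move: nV wV Tn; clear; lia.
suff [|] : (exists2 b, b \in B & forall i, i \notin b -> (r <= a i)%N) \/
    (r * (#|T| - n).+1 <= weight a T)%N; [by left|move=> HT; right; rewrite wT|].
  apply: (@leq_trans (r * (#|T| - n).+1 + r * (#|V| - #|T|))); last by rewrite leq_add2r.
  by rewrite -mulnDr leq_mul2l; apply/orP; right; move: nV wV nT; clear; lia.
have [|s0 [_ s0T cs0]] := exists_set_between (finset.sub0set T) (d := n); first by rewrite cards0.
pose P := [pred s : {set V} | (s \subset T) && (#|s| == n)].
have Ps0 : P s0 by rewrite /= s0T cs0 eqxx.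
have [s /= /andP[sT /eqP cs] smin] := @arg_minnP _ s0 P (weight a) Ps0.
have s_le i j : i \in s -> j \in T :\: s -> (a i <= a j)%N.
  move=> si /setDP[jT js]; rewrite -(leq_add2l (weight a s)) -(weight_swap a si js) leq_add2r.
  apply: smin; apply/andP; split.
    rewrite finset.subUset finset.sub1set jT /=.
    by apply: fintype.subset_trans sT; exact: subD1set.
  by rewrite cardsU1 !inE (negPf js) andbF /= -cs (cardsD1 i s) si.
have wTs : weight a T = (weight a s + weight a (T :\: s))%N.
  by rewrite (weight_setID _ _ s) (finset.setIidPr sT).
have cTs : #|T :\: s| = (#|T| - n)%N by rewrite cardsDS // cs.
(* If [s] is a basis, its weight is at least m and the other exponents of [T] are at least the mean
   over [s], so the mean over [T] is at least m/n. *)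
have [sB|sB] := boolP (s \in B); last first.
  right; apply: (@mean_bound n m r #|V|) => //; first by rewrite ltnW.
    by rewrite nT.
  have ms : (m <= weight a s)%N by apply: am; apply/basesP.
  have : (#|T :\: s| * weight a s <= weight (fun i => n * a i) (T :\: s))%N.
    by apply: weight_min => j jTs; rewrite -cs; apply: weight_max => i si; exact: s_le.
  rewrite /weight -big_distrr /= -!/(weight _ _) cTs -/(weight a s) wTs => h.
  rewrite mulnDr -{1}(subnKC nT) mulnDl leq_add //; first by rewrite leq_mul2l ms orbT.
  by apply: leq_trans h; rewrite leq_mul2l ms orbT.
have [Tn|Tn] := leqP #|T| n.
  left; exists T => [|i]; last by rewrite inE -leqNgt.
  by have /eqP <- : s == T by rewrite eqEcard sT cs.
have [|[j0 j0Ts]] := set_0Vmem (T :\: s).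
  by move=> e; move: cTs; rewrite e cards0; move: Tn; clear; lia.
have [j jTs jmin] := @arg_minnP _ j0 (mem (T :\: s)) a j0Ts.
have [jT js] := setDP jTs.
(* Swapping any [i] of the block for [j] gives a basis; the n resulting inequalities are summed. *)
have hS : (n * m + weight a s <= n * (weight a s + a j))%N.
  rewrite -{1 2}cs -!sum_nat_const {1}/weight -big_split /=; apply: leq_sum => i si.
  have := weight_swap a si js; rewrite addnC => <-.
  rewrite addnC leq_add2l; apply: am; apply/basesP; split; last exact: swap_notin_blocks.
  by rewrite cardsU1 !inE (negPf js) andbF /= -cs (cardsD1 i s) si.
have hx : (weight a s <= n * a j)%N by rewrite -cs; apply: weight_max => i si; exact: s_le.
have jr : (a j <= r)%N by move: jT; rewrite inE => /ltnW.
have hT : (weight a s + (#|T| - n) * a j <= weight a T)%N.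
  by rewrite wTs leq_add2l -cTs; apply: weight_min => i iTs; exact: jmin.
right; have [|h|h] := block_bound n2 _ hS hx jr rm1 (p := (#|T| - n)%N).
- by rewrite subn_gt0.
- exact: leq_trans hT.
apply: (@mean_bound n m r #|V|) => //; first by rewrite ltnW.
  by rewrite nT.
by apply: leq_trans (leq_trans h _); rewrite ?subnKC // leq_mul2l hT orbT.
Qed.

End SparsePaving.

(** * The resurgence *)

Lemma meval_linear_form (k : fieldType) n (p : mpoly n k) (x : 'I_n -> k) (c : k) :
  p \is ishomog1 1 (mdeg : measure n) -> meval (fun i => c * x i) p = c * meval x p.
Proof.
move=> /linear_formE ->; rewrite !raddf_sum big_distrr /=; apply: eq_bigr => i _.
by rewrite !mevalZ !mevalXU mulrCA.
Qed.

(** A nonzero common zero of n + 1 forms would span a point common to their hyperplanes. *)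
Lemma hyperplanes_general_position (k : fieldType) n (V : finType)
    (H : V -> set {vspace 'rV[k]_n.+1}) (l : V -> mpoly n.+1 k) :
  (forall j, defines_hyperplane (l j) (H j)) ->
  (forall s : {set V}, #|s| = n.+1 -> \bigcap_(j in [set` s]) H j = set0) ->
  general_position l.
Proof.
move=> hl Hempty e e_inj.
have lhom j : l j \is ishomog1 1 (mdeg : measure n.+1) by case: (hl j).
apply: (linear_coordinates (f := l \o e)) => [i|x lx]; first exact: lhom.
apply/eqP/negPn/negP => xn0.
have := Hempty (e @: finset.setT); rewrite (card_imset _ e_inj) cardsT card_ord => /(_ erefl).
apply/eqP/set0P; exists <[x]>%VS => _ /imsetP[i _ ->].
have [_ _ ->] := hl (e i); split; first by rewrite /proj_space /= dim_vline xn0.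
move=> y /vlineP[c ->].
rewrite -[RHS](mulr0 c) -(lx i) -meval_linear_form; last exact: lhom.
by apply: meval_eq => j; rewrite mxE.
Qed.

(** As t <= n - 1, the intersection contains a [t]-subset, which lies in only one block. *)
Lemma steiner_sparse (V : finType) t n v (B : {set {set V}}) : (t < n)%N ->
  steiner_system t n v B -> forall b b', b \in B -> b' \in B ->
  (n.-1 <= #|b :&: b'|)%N -> b = b'.
Proof.
move=> tn [_ cB uB] b b' bB b'B nbb'.
have [|T [_ Tbb' cT]] := exists_set_between (finset.sub0set (b :&: b')) (d := t).
  by rewrite cards0 (leq_trans _ nbb') // -ltnS prednK // (leq_trans _ tn).
have [c [_ cuniq]] := uB T cT.
rewrite -(cuniq b); last by split=> //; apply: fintype.subset_trans Tbb' (finset.subsetIl _ _).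
by apply: cuniq; split=> //; apply: fintype.subset_trans Tbb' (finset.subsetIr _ _).
Qed.

(** * Containment of symbolic powers in ordinary powers *)

Section Containment.
Variables (k : fieldType) (n : nat) (V : finType) (l : V -> mpoly n.+1 k).
Variable B : {set {set V}}.
Hypothesis n2 : (2 <= n)%N.
Hypothesis ltnV : (n < #|V|)%N.
Hypothesis coords : general_position l.
Hypothesis card_block : forall b, b \in B -> #|b| = n.
Hypothesis sparse : forall b b', b \in B -> b' \in B ->
  (n.-1 <= #|b :&: b'|)%N -> b = b'.

Local Notation I := (complement_ideal l B).

Lemma transversal_prod (D : {set V}) :
  (forall s, s \in bases n B -> exists2 i, i \in s & i \in D) -> I (\prod_(i in D) l i).
Proof.
move=> sD s /= [cs sB]; have [|i si iD] := sD s; first exact/basesP.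
have [_ _ IM] := @ideal_gen_ideal _ [set l i | i in [set` s]].
by rewrite (bigD1 i) //= mulrC; apply: IM; apply: sub_ideal_gen; exists i.
Qed.

Lemma symbolic_power_sub m r :
  (r * (2 * n - 1) <= m * n)%N -> (r * (n * (#|V| - n).+1) <= m * #|V|)%N ->
  symbolic_power I m `<=` ideal_power I r.
Proof.
move=> rm1 rm2; apply: classical_sets.subset_trans.
  exact: (symbolic_power_monomial ltnV coords (exchange_bases card_block sparse)).
have iI : is_ideal (ideal_power I r) := @ideal_gen_ideal _ _.
have [_ _ IM] := iI.
apply: ideal_gen_sub => // _ [a am <-].
have [[b bB ar]|wa] := truncated_weight card_block sparse n2 ltnV am rm1 rm2.
  (* The r-th power of the product of the forms outside [b] divides l^a; that product lies in [I]
     because no basis is contained in [b]. *)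
  have [|f ->] := @monomial_le _ _ l (fun i => indicator (~: b) i * r)%N a.
    move=> i; rewrite /indicator inE; have := ar i.
    by case: (i \in b) => //= /(_ isT); rewrite mul1n.
  apply: IM; rewrite /monomial.
  under eq_bigr => i _ do rewrite exprM.
  rewrite prodrXl -/(monomial l _) monomial_indicator; apply: ideal_powerX.
  apply: transversal_prod => s /basesP[cs sB].
  have /fintype.subsetPn[i si ib] : ~~ (s \subset b).
    apply: contra sB => sb; suff -> : s = b by [].
    by apply/eqP; rewrite eqEcard sb cs card_block ?leqnn.
  by exists i; rewrite ?inE.
have [|f ->] := @monomial_le _ _ l (fun i => minn (a i) r) a; first by move=> i; exact: geq_minl.
apply: IM; apply: (@monomial_in_power _ _ _ _ (#|V| - n).+1) => // [D dD s /= sM|i]; last first.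
  exact: geq_minr.
suff : I (\prod_(i in D) l i) by apply.
apply: transversal_prod => {sM}s /basesP[cs _].
(* An n-subset meets every set of at least v - n + 1 elements. *)
have /finset.set0Pn[i] : s :&: D != finset.set0.
  apply/negP => /eqP sD0; have := max_card (mem (s :|: D)).
  rewrite cardsU sD0 cards0 cs; move: ltnV dD; clear; lia.
by rewrite inE => /andP[]; exists i.
Qed.

End Containment.

Lemma ratio_bound (R : realType) (a b m r : nat) : (0 < b)%N -> (0 < r)%N ->
  (m * b < r * a)%N -> m%:R / r%:R <= a%:R / b%:R :> R.
Proof.
move=> b0 r0 h; rewrite ler_pdivrMr ?ltr0n // mulrAC ler_pdivlMr ?ltr0n //.
by rewrite -!natrM ler_nat mulnC [X in (_ <= X)%N]mulnC ltnW // mulnC.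
Qed.

Theorem corollary3p6 (R : realType) (k : fieldType) (t n v : nat)
    (B : {set {set 'I_v}})
    (H : 'I_v -> set {vspace 'rV[k]_n.+1}) (l : 'I_v -> mpoly n.+1 k)
    (ht : (1 <= t)%N) (htn : (t < n)%N) (hnv : (n < v)%N)
    (hB : steiner_system t n v B)
    (hl : forall j, defines_hyperplane (l j) (H j))
    (Hinj : injective H)
    (Hpoint : forall s : {set 'I_v}, #|s| = n ->
       exists p, \bigcap_(j in [set` s]) H j = [set p])
    (Hempty : forall s : {set 'I_v}, #|s| = n.+1 ->
       \bigcap_(j in [set` s]) H j = set0) :
  (resurgence R (complement_ideal l B) < n%:R%:E)%E.
Proof.
have n2 : (2 <= n)%N := leq_ltn_trans ht htn.
have n0 : (0 < n)%N := ltnW n2.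
have v0 : (0 < v)%N := ltn_trans n0 hnv.
(* If containment fails, m/r is below c1 = 2 - 1/n or c2 = n (v - n + 1)/v, so the supremum is at
   most their maximum; both are less than n because n >= 2. *)
pose c1 : R := (2 * n - 1)%:R / n%:R; pose c2 : R := (n * (v - n).+1)%:R / v%:R.
apply: (@le_lt_trans _ _ (Num.max c1 c2)%:E).
  apply: ge_ereal_sup => _ [m [r [m0 r0 mr ->]]]; rewrite lee_fin le_max.
  have [h1|h1] := leqP (r * (2 * n - 1)) (m * n); last by rewrite ratio_bound.
  have [h2|h2] := leqP (r * (n * (v - n).+1)) (m * v); last by rewrite orbC ratio_bound.
  case: mr; have [_ cB _] := hB.
  have lgp := hyperplanes_general_position hl Hempty.
  by apply: (symbolic_power_sub n2 _ lgp cB (steiner_sparse htn hB)) => //;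
    rewrite card_ord.
rewrite lte_fin gt_max; apply/andP; split; rewrite ltr_pdivrMr ?ltr0n // -natrM ltr_nat.
  by move: n2; clear; nia.
by rewrite ltn_pmul2l //; move: n2 hnv; clear; lia.
Qed.
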